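(* Let $A\subset\mathbb{N}$, and suppose that $\psi,\varphi\in\mathcal{D}$ satisfy $$\sum_{k=1}^n\psi'(k)\sim\psi(n)\quad\text{and}\quad\sum_{k=1}^n\varphi'(k)\sim\varphi(n),\qquad n\to\infty.$$ If $\psi$ is concave with respect to $\varphi$, then $$0\le\underline{\operatorname{d}}_{\varphi}(A)\le\underline{\operatorname{d}}_{\psi}(A)\le\overline{\operatorname{d}}_{\psi}(A)\le\overline{\operatorname{d}}_{\varphi}(A)\le1.$$
   Context: $\mathbb{N}=\{1,2,3,\dots\}$ and $\chi_A$ is the characteristic function of $A$. $\mathcal{D}$ denotes the class of strictly increasing, differentiable, unbounded functions $\psi:(0,\infty)\to(0,\infty)$; for such functions it is understood that $\psi'(x)>0$ for all $x>0$. For $\psi\in\mathcal{D}$ and $A\subset\mathbb{N}$, the lower and upper $\psi$-densities are $$\underline{\operatorname{d}}_\psi(A)=\liminf_{n\to\infty}\frac{\sum_{k=1}^n\psi'(k)\chi_A(k)}{\sum_{k=1}^n\psi'(k)},\qquad \overline{\operatorname{d}}_\psi(A)=\limsup_{n\to\infty}\frac{\sum_{k=1}^n\psi'(k)\chi_A(k)}{\sum_{k=1}^n\psi'(k)}.$$ For $\psi,\varphi\in\mathcal{D}$, $\psi$ is said to be concave with respect to $\varphi$ (equivalently, $\varphi$ is convex with respect to $\psi$) if $\varphi\circ\psi^{-1}$ is convex; equivalently, the quotient $\varphi'(x)/\psi'(x)$ is increasing (in the non-strict sense) for $x\in(0,\infty)$. The notation $f(n)\sim g(n)$ means $f(n)/g(n)\to1$.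 *)

(* Defs.v *)
From HB Require Import structures.
From mathcomp Require Import all_boot all_order all_algebra.
From mathcomp Require Import all_classical all_reals all_analysis.

Set Implicit Arguments.
Unset Strict Implicit.
Unset Printing Implicit Defensive.

Import Order.TTheory GRing.Theory Num.Theory.
Import numFieldNormedType.Exports.

Local Open Scope classical_set_scope.
Local Open Scope ring_scope.

(* A function (0, oo) -> (0, oo) is represented by a total function on R; its
   values at nonpositive reals are unconstrained and never used. *)
Record class_D (R : realType) (psi : R -> R) : Prop := ClassD {
  class_D_pos : forall x : R, 0 < x -> 0 < psi x;
  class_D_incr : forall x y : R, 0 < x -> x < y -> psi x < psi y;
  class_D_derivable : forall x : R, 0 < x -> derivable psi x 1;
  class_D_derive_pos : forall x : R, 0 < x -> 0 < derive1 psi x;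
  class_D_unbounded : ~ has_ubound (psi @` `]0, +oo[%classic) }.

(* For n = 0 this is 0 / 0 = 0, which the limits below do not see. *)
Definition density_ratio (R : realType) (psi : R -> R) (A : set nat)
    (n : nat) : R :=
  (\sum_(1 <= k < n.+1) derive1 psi k%:R * \1_A k)
  / \sum_(1 <= k < n.+1) derive1 psi k%:R.

(* The limits are taken in \bar R, where the limit inferior and superior of
   every sequence exist. *)
Definition lower_density (R : realType) (psi : R -> R) (A : set nat) : \bar R :=
  limn_einf (fun n => (density_ratio psi A n)%:E).

Definition upper_density (R : realType) (psi : R -> R) (A : set nat) : \bar R :=
  limn_esup (fun n => (density_ratio psi A n)%:E).

(* Convexity of phi \o psi^-1 on psi((0, oo)), where psi^-1 is the inverse of
   the restriction of psi to (0, oo). *)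
Definition concave_wrt (R : realType) (psi phi : R -> R) : Prop :=
  @convex_function R R^o (psi @` `]0, +oo[%classic)
    (phi \o pinv (`]0, +oo[%classic : set R) psi).

Definition asymp_equiv (R : realType) (f g : nat -> R) : Prop :=
  (fun n => f n / g n) @ \oo --> (1 : R).

(* Main.v *)
Require Import Defs.
From HB Require Import structures.
From mathcomp Require Import all_boot all_order all_algebra.
From mathcomp Require Import all_classical all_reals all_analysis.
From mathcomp Require Import lra.

(** Put [p k = psi'(k)] and [q k = phi'(k)], so that both densities are limits
    of weighted averages of the indicator of [A].  Relative concavity says that
    the ratio [w k = p k / q k] is nonincreasing ([derive1_ratio_le]), so the
    [p]-weights are obtained from the [q]-weights by damping later indices.

    Suppose the [q]-averages of a sequence [a] are eventually at most [c].  Then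
    the partial sums of [q k * (a k - c)] are bounded above by some [M], and
    Abel's inequality ([abel_inequality]) bounds the partial sums of
    [p k * (a k - c) = w k * (q k * (a k - c))] by [w 1 * M], uniformly in [n].
    The sums of the [p k] tend to infinity, since they are asymptotic to [psi]
    ([sum_derive1_cvgy]); after division by them the bound vanishes, and the
    [p]-averages have limit superior at most [c].  This gives the inequality
    between limits superior ([limn_esup_wavg]) for every real sequence [a], and
    applying it to [- a] gives the one between limits inferior. *)

Set Implicit Arguments.
Unset Strict Implicit.
Unset Printing Implicit Defensive.

Import Order.TTheory GRing.Theory Num.Theory.
Import numFieldNormedType.Exports.

Local Open Scope classical_set_scope.
Local Open Scope ring_scope.

(** * Comparison of weighted averages *)

(** Subtracting the slack term [w n * (M - X n)], where [X n] is the [n]-th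
    partial sum of [x], makes the induction go through without summation by
    parts: passing from [n] to [n.+1] only uses
    [w n.+1 * (M - X n) <= w n * (M - X n)]. *)
Lemma abel_inequality (R : realFieldType) (w x : nat -> R) (M : R) :
  (forall k, (0 < k)%N -> 0 <= w k) ->
  (forall k, (0 < k)%N -> w k.+1 <= w k) ->
  (forall n, (0 < n)%N -> \sum_(1 <= k < n.+1) x k <= M) ->
  forall n, (0 < n)%N -> \sum_(1 <= k < n.+1) w k * x k <= w 1 * M.
Proof.
move=> w0 wd xM.
suff H n : \sum_(1 <= k < n.+2) w k * x k <=
    w 1 * M - w n.+1 * (M - \sum_(1 <= k < n.+2) x k).
  move=> [//|n] _; apply: (le_trans (H n)).
  by rewrite gerBl mulr_ge0 ?w0// subr_ge0 xM.
elim: n => [|n IH]; first by rewrite !big_nat1; lra.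
rewrite big_nat_recr//= [X in _ <= _ - _ * (_ - X)]big_nat_recr//=.
have := ler_wpM2r (_ : 0 <= M - \sum_(1 <= k < n.+2) x k) (wd n.+1 isT).
rewrite subr_ge0 xM// => /(_ isT); lra.
Qed.

Lemma near_infty_ubound (R : realFieldType) (u : nat -> R) (c : R) :
  (\forall n \near \oo, u n <= c) -> exists M, forall n, u n <= M.
Proof.
move=> [N _ uN]; exists (`|c| + \sum_(k < N) `|u k|) => n.
have [nN|Nn] := ltnP n N; last first.
  rewrite (le_trans (uN n Nn))// (le_trans (ler_norm c))// lerDl.
  exact: sumr_ge0.
rewrite (le_trans (ler_norm _))// (bigD1 (Ordinal nN))//= addrCA lerDl.
by rewrite addr_ge0// sumr_ge0.
Qed.

Lemma limn_esup_le_near (R : realType) (u : nat -> \bar R) (c : \bar R) :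
  (\forall n \near \oo, (u n <= c)%E) -> (limn_esup u <= c)%E.
Proof.
move=> uc; apply: (@le_trans _ _ (ereal_sup (u @` [set n | (u n <= c)%E]))).
  by apply: ereal_inf_lbound; exists [set n | (u n <= c)%E].
by apply: ge_ereal_sup => _ [n /= un <-].
Qed.

Definition wavg (R : realType) (p a : nat -> R) (n : nat) : R :=
  (\sum_(1 <= k < n.+1) p k * a k) / \sum_(1 <= k < n.+1) p k.

Lemma wavgN (R : realType) (p a : nat -> R) (n : nat) :
  wavg p (fun k => - a k) n = - wavg p a n.
Proof. by rewrite /wavg -mulNr -sumrN; under eq_bigr do rewrite mulrN. Qed.

Lemma sum_weights_gt0 (R : realType) (p : nat -> R) (n : nat) :
  (forall k, (0 < k)%N -> 0 < p k) -> (0 < n)%N ->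
  0 < \sum_(1 <= k < n.+1) p k.
Proof.
case: n => // n p0 _; elim: n => [|n IH]; first by rewrite big_nat1 p0.
by rewrite big_nat_recr//= addr_gt0// p0.
Qed.

Lemma wavg_le (R : realType) (p a : nat -> R) (c : R) (n : nat) :
  (forall k, (0 < k)%N -> 0 < p k) -> (0 < n)%N ->
  (wavg p a n <= c) = (\sum_(1 <= k < n.+1) p k * (a k - c) <= 0).
Proof.
move=> p0 n0; rewrite /wavg ler_pdivrMr ?sum_weights_gt0//.
under [in RHS]eq_bigr do rewrite mulrBr.
by rewrite sumrB -mulr_suml subr_le0 [c * _]mulrC.
Qed.

(** The uniform bound from Abel's inequality costs an arbitrarily small [e]
    once the total [p]-weight is large. *)
Lemma near_wavg_le (R : realType) (p q a : nat -> R) (c e : R) :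
  (forall k, (0 < k)%N -> 0 < p k) -> (forall k, (0 < k)%N -> 0 < q k) ->
  (forall k, (0 < k)%N -> p k.+1 / q k.+1 <= p k / q k) ->
  \sum_(1 <= k < n.+1) p k @[n --> \oo] --> +oo ->
  (\forall n \near \oo, wavg q a n <= c) -> 0 < e ->
  \forall n \near \oo, wavg p a n <= c + e.
Proof.
move=> p0 q0 pq poo qc e0.
have [M xM] : exists M, forall n, \sum_(1 <= k < n.+1) q k * (a k - c) <= M.
  apply: (@near_infty_ubound _ _ 0); near=> n.
  by rewrite -wavg_le//; [near: n|near: n; exact: nbhs_infty_gt].
have Ab n : (0 < n)%N ->
    \sum_(1 <= k < n.+1) p k * (a k - c) <= p 1 / q 1 * M.
  move=> n0.
  rewrite (eq_big_nat _ _ (F2 := fun k => p k / q k * (q k * (a k - c)))).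
    by apply: (@abel_inequality _ (fun k => p k / q k)) => // k k0;
      rewrite divr_ge0// ltW// ?p0 ?q0.
  by move=> k /andP[k0 _]; rewrite mulrA divfK// gt_eqF// q0.
near=> n.
have n0 : (0 < n)%N by near: n; exact: nbhs_infty_gt.
have Pn : p 1 / q 1 * M / e <= \sum_(1 <= k < n.+1) p k.
  by near: n; move/cvgryPge : poo; exact.
move: Pn; rewrite ler_pdivrMr// wavg_le// => Pn.
under eq_bigr do rewrite opprD addrA mulrBr.
by rewrite sumrB -mulr_suml subr_le0 (le_trans (Ab n n0)).
Unshelve. all: by end_near. Qed.

Lemma limn_esup_wavg (R : realType) (p q a : nat -> R) :
  (forall k, (0 < k)%N -> 0 < p k) -> (forall k, (0 < k)%N -> 0 < q k) ->
  (forall k, (0 < k)%N -> p k.+1 / q k.+1 <= p k / q k) ->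
  \sum_(1 <= k < n.+1) p k @[n --> \oo] --> +oo ->
  (limn_esup (fun n => (wavg p a n)%:E) <=
   limn_esup (fun n => (wavg q a n)%:E))%E.
Proof.
move=> p0 q0 pq poo; apply: le_ereal_inf_tmp => _ [B Boo <-].
have uB n : B n ->
    ((wavg q a n)%:E <= ereal_sup [set (wavg q a m)%:E | m in B])%E.
  by move=> Bn; apply: ereal_sup_ubound; exists n.
(* Only a finite supremum matters: [-oo] is excluded as [B] is nonempty. *)
case: (ereal_sup _) uB => [c| |] uB; last 2 first.
- by rewrite leey.
- by have [N _ /(_ N (leqnn N)) /uB] := Boo.
apply/lee_addgt0Pr => e e0; apply: limn_esup_le_near.
have qc : \forall n \near \oo, wavg q a n <= c.
  by apply: filterS Boo => n /uB; rewrite lee_fin.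
by apply: filterS (near_wavg_le p0 q0 pq poo qc e0) => n; rewrite -EFinD lee_fin.
Qed.

Lemma limn_einf_wavgN (R : realType) (p a : nat -> R) :
  limn_einf (fun n => (wavg p a n)%:E) =
  (- limn_esup (fun n => (wavg p (fun k => - a k) n)%:E))%E.
Proof.
by rewrite /limn_einf; congr (- limn_esup _)%E; apply/funext => n; rewrite wavgN.
Qed.

Lemma limn_einf_wavg (R : realType) (p q a : nat -> R) :
  (forall k, (0 < k)%N -> 0 < p k) -> (forall k, (0 < k)%N -> 0 < q k) ->
  (forall k, (0 < k)%N -> p k.+1 / q k.+1 <= p k / q k) ->
  \sum_(1 <= k < n.+1) p k @[n --> \oo] --> +oo ->
  (limn_einf (fun n => (wavg q a n)%:E) <=
   limn_einf (fun n => (wavg p a n)%:E))%E.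
Proof. by move=> *; rewrite !limn_einf_wavgN leeN2; exact: limn_esup_wavg. Qed.

(** * Derivatives and relative concavity *)

Lemma derive_ge0_right (R : realType) (g : R -> R) (x v : R) :
  derivable g x v -> (\forall h \near 0^'+, g x <= g (h * v + x)) ->
  0 <= 'D_v g x.
Proof.
move=> dg gx.
have dgr : h^-1 *: ((g \o shift x) (h *: v) - g x) @[h --> 0^'+] --> 'D_v g x.
  exact: cvg_dnbhs_at_right.
apply: (cvgr_to_ge dgr); near=> h; apply: mulr_ge0.
  by rewrite invr_ge0 ltW//; near: h; exact: nbhs_right_gt.
by rewrite subr_ge0; near: h.
Unshelve. all: by end_near. Qed.

Lemma deriveNv (R : realType) (g : R -> R) (x v : R) :
  derivable g x 1 -> 'D_(- v) g x = - 'D_v g x.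
Proof. by move=> /derivable1_diffP dg; rewrite !deriveE// linearN. Qed.

Lemma class_D_inj (R : realType) (psi : R -> R) : class_D psi ->
  {in (`]0, +oo[%classic : set R) &, injective psi}.
Proof.
move=> Dpsi x y; rewrite !inE /= !in_itv /= !andbT => x0 y0 E.
have [xy|yx|//] := ltgtP x y.
- by have := class_D_incr Dpsi x0 xy; rewrite E ltxx.
- by have := class_D_incr Dpsi y0 yx; rewrite E ltxx.
Qed.

(** Since [psi] is increasing, [psi u] is a convex combination of [psi x] and
    [psi y], of weight [t] on [psi x]; clearing the denominator of [t] in the
    convexity inequality for [phi \o psi^-1] gives the chord inequality. *)
Lemma concave_wrt_chord (R : realType) (psi phi : R -> R) (x u y : R) :
  class_D psi -> concave_wrt psi phi -> 0 < x -> x < u -> u < y ->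
  (phi u - phi x) * (psi y - psi x) <= (phi y - phi x) * (psi u - psi x).
Proof.
move=> Dpsi cc x0 xu uy.
have u0 : 0 < u by lra.
have y0 : 0 < y by lra.
have pxu : psi x < psi u by apply: class_D_incr.
have puy : psi u < psi y by apply: class_D_incr.
have pxy : 0 < psi y - psi x by lra.
pose t := (psi y - psi u) / (psi y - psi x).
have tE : t * (psi y - psi x) = psi y - psi u by rewrite divfK// gt_eqF.
have t0 : 0 <= t by rewrite divr_ge0//; lra.
have t1 : t <= 1 by rewrite ler_pdivrMr//; lra.
have im (z : R) : 0 < z -> psi z \in (psi @` `]0, +oo[%classic).
  by move=> z0; rewrite inE; exists z => //=; rewrite in_itv/= z0.
have pK (z : R) : 0 < z -> pinv (`]0, +oo[%classic : set R) psi (psi z) = z.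
  by move=> z0; rewrite pinvKV//; [exact: class_D_inj|rewrite inE/= in_itv/= z0].
pose f := phi \o pinv (`]0, +oo[%classic : set R) psi.
have : f (t * psi x + (1 - t) * psi y) <=
    t * f (psi x) + (1 - t) * f (psi y).
  exact: (cc (Itv01 t0 t1) _ _ (im x x0) (im y y0)).
rewrite (_ : t * psi x + (1 - t) * psi y = psi u); last by lra.
rewrite /f /= !pK// => /(ler_wpM2r (ltW pxy)).
suff -> : (t * phi x + (1 - t) * phi y) * (psi y - psi x) =
  (psi y - psi u) * phi x + (psi u - psi x) * phi y by lra.
rewrite mulrDl mulrAC tE mulrAC; congr (_ + _ * _).
by rewrite mulrBl mul1r tE; lra.
Qed.

(** Let [g] be the chord of [phi] against [psi] over [x, y] minus the function
    itself, scaled by [psi y - psi x].  It is nonnegative between [x] and [y]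
    and vanishes at both, so its derivative is nonnegative at [x] and
    nonpositive at [y]: the slope of the chord separates
    [phi'(x) / psi'(x)] from [phi'(y) / psi'(y)]. *)
Lemma derive1_ratio_le (R : realType) (psi phi : R -> R) (x y : R) :
  class_D psi -> class_D phi -> concave_wrt psi phi -> 0 < x -> x < y ->
  derive1 psi y / derive1 phi y <= derive1 psi x / derive1 phi x.
Proof.
move=> Dpsi Dphi cc x0 xy; have y0 := lt_trans x0 xy.
pose a := phi y - phi x; pose b := psi y - psi x.
have a0 : 0 < a by rewrite subr_gt0 class_D_incr.
have b0 : 0 < b by rewrite subr_gt0 class_D_incr.
pose g : R -> R := a *: (psi - cst (psi x)) - b *: (phi - cst (phi x)).
have gE u : g u = a * (psi u - psi x) - b * (phi u - phi x) by [].
have g0 u : x < u -> u < y -> 0 <= g u.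
  move=> xu uy; rewrite gE subr_ge0 mulrC.
  exact: concave_wrt_chord.
have gx : g x = 0 by rewrite gE !subrr !mulr0 subrr.
have gy : g y = 0 by rewrite gE mulrC subrr.
have dg (z : R) : 0 < z -> is_derive z 1 g (a * derive1 psi z - b * derive1 phi z).
  move=> z0; rewrite !derive1E.
  have /derivableP ? := class_D_derivable Dpsi z0.
  have /derivableP ? := class_D_derivable Dphi z0.
  by apply: is_derive_eq; rewrite !subr0.
have [dgx Dgx] := dg x x0; have [dgy Dgy] := dg y y0.
have gx0 : 0 <= 'D_1 g x.
  apply: derive_ge0_right => //; near=> h.
  have h0 : 0 < h by near: h; exact: nbhs_right_gt.
  have hxy : h < y - x by near: h; apply: nbhs_right_lt; rewrite subr_gt0.
  by rewrite gx g0; lra.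
have gy0 : 0 <= 'D_(-1) g y.
  apply: derive_ge0_right.
    by apply: diff_derivable; exact/derivable1_diffP.
  near=> h.
  have h0 : 0 < h by near: h; exact: nbhs_right_gt.
  have hxy : h < y - x by near: h; apply: nbhs_right_lt; rewrite subr_gt0.
  by rewrite gy g0; lra.
rewrite deriveNv// in gy0.
have px := class_D_derive_pos Dphi x0; have py := class_D_derive_pos Dphi y0.
(* [b / a] is the inverse of the slope of the chord. *)
apply: (@le_trans _ _ (b / a)).
  rewrite ler_pdivrMr// mulrAC ler_pdivlMr// mulrC; lra.
rewrite ler_pdivrMr// mulrAC ler_pdivlMr//; lra.
Unshelve. all: by end_near. Qed.

(** * Densities *)

Lemma class_D_cvgy (R : realType) (psi : R -> R) :
  class_D psi -> psi n%:R @[n --> \oo] --> +oo.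
Proof.
move=> Dpsi; apply/cvgryPge => B.
have [x x0 Bx] : exists2 x, 0 < x & B < psi x.
  apply: contrapT => nB; apply: (class_D_unbounded Dpsi); exists B => _ [x + <-].
  rewrite /= in_itv/= andbT => x0; rewrite leNgt; apply/negP => Bx.
  by apply: nB; exists x.
near=> n; apply: (le_trans (ltW Bx)); apply/ltW/class_D_incr => //.
by near: n; exact: nbhs_infty_gtr.
Unshelve. all: by end_near. Qed.

Lemma sum_derive1_cvgy (R : realType) (psi : R -> R) : class_D psi ->
  asymp_equiv (fun n => \sum_(1 <= k < n.+1) derive1 psi k%:R)
              (fun n => psi n%:R) ->
  \sum_(1 <= k < n.+1) derive1 psi k%:R @[n --> \oo] --> +oo.
Proof.
move=> Dpsi sim; have /cvgryPge psiy := class_D_cvgy Dpsi.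
apply/cvgryPge => B; near=> n.
have n0 : (0 < n)%N by near: n; exact: nbhs_infty_gt.
have p0 : 0 < psi n%:R by apply: class_D_pos => //; rewrite ltr0n.
have pB : 2 * B <= psi n%:R by near: n; exact: psiy.
have : 2^-1 <= (\sum_(1 <= k < n.+1) derive1 psi k%:R) / psi n%:R.
  near: n; apply: (cvgr_ge (1 : R)) => //; lra.
by rewrite ler_pdivlMr//; lra.
Unshelve. all: by end_near. Qed.

Theorem theorem2p6 (R : realType) (A : set nat) (psi phi : R -> R)
    (hA : A `<=` [set n | (0 < n)%N])
    (hpsi : class_D psi) (hphi : class_D phi)
    (hpsi_sum : asymp_equiv (fun n => \sum_(1 <= k < n.+1) derive1 psi k%:R)
                            (fun n => psi n%:R))
    (hphi_sum : asymp_equiv (fun n => \sum_(1 <= k < n.+1) derive1 phi k%:R)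
                            (fun n => phi n%:R))
    (hconc : concave_wrt psi phi) :
  [/\ (0 <= lower_density phi A)%E,
      (lower_density phi A <= lower_density psi A)%E,
      (lower_density psi A <= upper_density psi A)%E,
      (upper_density psi A <= upper_density phi A)%E &
      (upper_density phi A <= 1)%E].
Proof.
pose p k : R := derive1 psi k%:R; pose q k : R := derive1 phi k%:R.
pose a k : R := \1_A k.
have p0 k : (0 < k)%N -> 0 < p k.
  by move=> k0; apply: class_D_derive_pos => //; rewrite ltr0n.
have q0 k : (0 < k)%N -> 0 < q k.
  by move=> k0; apply: class_D_derive_pos => //; rewrite ltr0n.
have pq k : (0 < k)%N -> p k.+1 / q k.+1 <= p k / q k.
  by move=> k0; apply: derive1_ratio_le; rewrite ?ltr0n ?ltr_nat.
have poo := sum_derive1_cvgy hpsi hpsi_sum.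
have a01 k : 0 <= a k <= 1.
  by rewrite /a indicE; case: (_ \in _); rewrite /= ?lexx ?ler01.
have le1 c b : (forall k, b k <= c) ->
    (limn_esup (fun n => (wavg q b n)%:E) <= c%:E)%E.
  move=> bc; apply: limn_esup_le_near; near=> n.
  have n0 : (0 < n)%N by near: n; exact: nbhs_infty_gt.
  rewrite lee_fin wavg_le// big_nat_cond sumr_le0// => k /andP[/andP[k0 _] _].
  by rewrite mulr_ge0_le0 ?subr_le0// ltW// q0.
split.
- have := limn_einf_wavgN q a; rewrite /lower_density => ->.
  by rewrite leeNr oppe0; apply: le1 => k; rewrite oppr_le0; case/andP: (a01 k).
- exact: (limn_einf_wavg a p0 q0 pq poo).
- exact: limn_einf_sup.
- exact: (limn_esup_wavg a p0 q0 pq poo).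
- by apply: (le1 1 a) => k; case/andP: (a01 k).
Unshelve. all: by end_near. Qed.
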